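(* Let $q\in\mathbb N_1$ and let $P_\bullet=(P_n)_{n\ge0}$ be a multipartition structure with $P_n[A]>0$ for every $A\in\mathcal M^{(q)}_n$ and every $n\ge1$, satisfying $$a\,\lambda^{(j)}_a\,P_n[A]=b(n,a,j)\,P_{n-a}[A-\mathbf 1_{a\mathbf e_j}]$$ for every $n\in\mathbb N_1$, $A\in\mathcal M^{(q)}_n$, $j\in[q]$ and every $a$ with $\lambda^{(j)}_a:=A(a\mathbf e_j)\ge1$, for some constant $b(n,a,j)$ independent of $A$. Then there is a unique $\boldsymbol\theta\in(0,\infty)^q$ such that $P_n=M^{\mathrm{Ewens}}_{\boldsymbol\theta;n}$ for every $n$. Furthermore, $b(n,a,j)=b_*(n,a\mathbf e_j)$, where $$b_*(n,\mathbf r)=\binom{|\mathbf r|}{\mathbf r}\,\theta\,m_{\mathbf r}(\nu)\,\frac{\langle\theta\rangle_{n-|\mathbf r|}}{\langle\theta\rangle_n}\,\frac{n!}{(n-|\mathbf r|)!}\quad\text{with}\quad\theta=|\boldsymbol\theta|,\quad\nu=|\boldsymbol\theta|^{-1}\sum_{j=1}^q\theta_j\delta_{\mathbf e_j}.$$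
   Context: Notation: $\mathbb N_1=\{1,2,\dots\}$, $\mathbb N_0=\{0,1,\dots\}$, $[q]=\{1,\dots,q\}$, $\mathbb N^q_*=\mathbb N_0^q\setminus\{\mathbf 0\}$, $0^0=1$; $|\mathbf a|=\sum_j|a_j|$, $\binom{|\mathbf r|}{\mathbf r}=|\mathbf r|!/\prod_jr_j!$; $\mathbf e_j$ canonical basis vectors; $\langle\theta\rangle_n=\theta(\theta+1)\cdots(\theta+n-1)$, $\langle\theta\rangle_0=1$; $m_{\mathbf r}(\nu)=\int\prod_ju_j^{r_j}\,d\nu(\mathbf u)$ for a probability measure $\nu$ on $\Delta^{q-1}=\{\mathbf u\in[0,1]^q:|\mathbf u|=1\}$. A $q$-chromatic partition of $n$ is a finitely supported map $A\colon\mathbb N^q_*\to\mathbb N_0$ with $\sum_{\mathbf a}A(\mathbf a)|\mathbf a|=n$; $\mathcal A^{(q)}_n$ is the set of these ($\mathcal A^{(q)}_0=\{0\}$); $\mathbf 1_{\mathbf a}$ is the multiset with single element $\mathbf a$; operations pointwise. $\mathcal M^{(q)}_n\subset\mathcal A^{(q)}_n$ is the set of multipartitions: those $A$ such that $A(\mathbf a)>0$ implies $\mathbf a=a\,\mathbf e_j$ for some $a\in[n]$, $j\in[q]$ ($\mathcal M^{(q)}_0=\{0\}$). For $\mathbf a\in\mathrm{supp}A$, $a_j\ge1$: $A_{\setminus\mathbf a,j}=A-\mathbf 1_{\mathbf a}$ if $\mathbf a=\mathbf e_j$, else $A-\mathbf 1_{\mathbf a}+\mathbf 1_{\mathbf a-\mathbf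 e_j}$. A multipartition structure is a sequence $(P_n)_{n\ge0}$ of probability measures on $\mathcal A^{(q)}_n$, each concentrated on $\mathcal M^{(q)}_n$, with $P_{n-1}[B]=\sum_{A\in\mathcal A^{(q)}_n}P_n[A]S_{n-1,n}(A,B)$ for $n\ge1$, where $S_{n-1,n}(A,B)=a_jA(\mathbf a)/n$ if $B=A_{\setminus\mathbf a,j}$, and $0$ otherwise. Refined Ewens Sampling Formula: for $A\in\mathcal M^{(q)}_n$, $\lambda^{(j)}_a=A(a\,\mathbf e_j)$, $$M^{\mathrm{Ewens}}_{\boldsymbol\theta;n}[A]=\frac{n!}{\langle|\boldsymbol\theta|\rangle_n}\prod_{j=1}^q\prod_{a=1}^n\Big(\frac{\theta_j}a\Big)^{\lambda^{(j)}_a}\frac1{\lambda^{(j)}_a!}.$$ *)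

(* Defs.v *)
From HB Require Import structures.
From mathcomp Require Import all_boot all_order all_algebra.
From mathcomp Require Import finmap multiset.
From mathcomp Require Import all_classical all_reals all_analysis.

Set Implicit Arguments.
Unset Strict Implicit.
Unset Printing Implicit Defensive.
Import Order.TTheory GRing.Theory Num.Theory.
Import numFieldNormedType.Exports.

Local Open Scope classical_set_scope.
Local Open Scope ring_scope.

Notation color q := {ffun 'I_q -> nat}.

Definition color_size (q : nat) (a : color q) : nat := (\sum_(j < q) a j)%N.

Definition mono_color (q : nat) (a : nat) (j : 'I_q) : color q :=
  [ffun i => if i == j then a else 0%N].

Definition color_pred (q : nat) (a : color q) (j : 'I_q) : color q :=
  [ffun i => (a i - (i == j))%N].

(* A finitely supported map on N_0^q without the zero vector is encoded as a
   finitely supported map on all of N_0^q taking the value 0 at the zero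
   vector. *)
Definition chromatic_partition (q n : nat) : set {mset color q}%mset :=
  [set A : {mset color q}%mset | A [ffun=> 0%N] = 0%N /\
           (\sum_(a <- finsupp A) A a * color_size a = n)%N].

Definition multipartition (q n : nat) : set {mset color q}%mset :=
  [set A : {mset color q}%mset | chromatic_partition n A /\
           forall a : color q, (0 < A a)%N ->
             exists k : nat, exists j : 'I_q,
               (1 <= k <= n)%N /\ a = mono_color k j].

Definition remove_one (q : nat) (A : {mset color q}%mset) (a : color q)
    (j : 'I_q) : {mset color q}%mset :=
  if a == mono_color 1 j then (A `\` [mset a])%mset
  else ((A `\` [mset a]) `+` [mset color_pred a j])%mset.

(* S_{n-1,n}(A, B).  The pair (a, j) with B = remove_one A a j is unique when it
   exists (for A without the zero vector), so the value does not depend on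
   which pair is picked. *)
Definition removal_kernel (R : realType) (q n : nat)
    (A B : {mset color q}%mset) : R :=
  if [pick p : finsupp A * 'I_q |
        (0 < val p.1 p.2)%N && (B == remove_one A (val p.1) p.2)] is Some p
  then (val p.1 p.2 * A (val p.1))%:R / n%:R
  else 0.

(* A probability measure on the finite set D, given by its mass function
   extended by 0 outside D. *)
Definition prob_on (R : realType) (T : choiceType) (D : set T) (p : T -> R) :=
  [/\ forall x, 0 <= p x, forall x, ~ D x -> p x = 0 & \sum_(x \in D) p x = 1].

Definition multipartition_structure (R : realType) (q : nat)
    (P : nat -> {mset color q}%mset -> R) : Prop :=
  [/\ forall n, prob_on (@chromatic_partition q n) (P n),
      forall n A, ~ multipartition n A -> P n A = 0
    & forall n B, chromatic_partition n B ->
        P n B = \sum_(A \in @chromatic_partition q n.+1)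
                   P n.+1 A * removal_kernel R n.+1 A B].

Definition rising (R : realType) (x : R) (n : nat) : R :=
  \prod_(i < n) (x + i%:R).

Definition total_mass (R : realType) (q : nat)
    (theta : {ffun 'I_q -> {posnum R}}) : R :=
  \sum_(j < q) (theta j)%:num.

Definition refined_ewens (R : realType) (q : nat)
    (theta : {ffun 'I_q -> {posnum R}}) (n : nat) : {mset color q}%mset -> R :=
  (fun A => n`!%:R / rising (total_mass theta) n *
     \prod_(j < q) \prod_(1 <= a < n.+1)
        (((theta j)%:num / a%:R) ^+ A (mono_color a j)
         / (A (mono_color a j))`!%:R)) \_ (@multipartition q n).

Definition simplex (R : realType) (q : nat) : set (q.-tuple R) :=
  [set u | (forall j, 0 <= tnth u j <= 1) /\ \sum_(j < q) tnth u j = 1].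

Definition moment (R : realType) (q : nat)
    (nu : {measure set (q.-tuple R) -> \bar R}) (r : color q) : R :=
  \int[nu]_(u in @simplex R q) \prod_(j < q) tnth u j ^+ r j.

Definition b_star (R : realType) (q : nat) (theta : R)
    (nu : {measure set (q.-tuple R) -> \bar R}) (n : nat) (r : color q) : R :=
  (color_size r)`!%:R / \prod_(j < q) (r j)`!%:R * theta * moment nu r
  * (rising theta (n - color_size r) / rising theta n)
  * (n`!%:R / (n - color_size r)`!%:R).

Definition basis_vector (R : realType) (q : nat) (j : 'I_q) : q.-tuple R :=
  [tuple (i == j)%:R | i < q].

Definition vertex_measure (R : realType) (q : nat)
    (theta : {ffun 'I_q -> {posnum R}}) (U : set (q.-tuple R)) : \bar R :=
  (((total_mass theta)^-1)%:E
   * \sum_(j < q) ((theta j)%:num%:E * \d_(basis_vector R j) U))%E.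

Section vertex_measure_is_measure.
Variables (R : realType) (q : nat) (theta : {ffun 'I_q -> {posnum R}}).

Lemma total_mass_ge0 : 0 <= total_mass theta.
Proof. by apply: sumr_ge0 => j _. Qed.

Let weight (k : nat) : {measure set (q.-tuple R) -> \bar R} :=
  if insub k is Some j
  then mscale (theta j)%:num%:nng (\d_(basis_vector R j))
  else mzero.

Let inv_total_mass_ge0 : 0 <= (total_mass theta)^-1.
Proof. by rewrite invr_ge0 total_mass_ge0. Qed.

Let vertex_measureE :
  vertex_measure theta = mscale (NngNum inv_total_mass_ge0) (msum weight q).
Proof.
apply/funext => U; rewrite /vertex_measure /mscale /= /msum; congr (_ * _)%E.
by apply: eq_bigr => j _; rewrite /weight valK.
Qed.

Let vertex_measure0 : vertex_measure theta set0 = 0%E.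
Proof. by rewrite vertex_measureE measure0. Qed.

Let vertex_measure_ge0 U : (0 <= vertex_measure theta U)%E.
Proof. by rewrite vertex_measureE measure_ge0. Qed.

Let vertex_measure_sigma_additive : semi_sigma_additive (vertex_measure theta).
Proof. by rewrite vertex_measureE; exact: measure_semi_sigma_additive. Qed.

HB.instance Definition _ := isMeasure.Build _ _ _ (vertex_measure theta)
  vertex_measure0 vertex_measure_ge0 vertex_measure_sigma_additive.

End vertex_measure_is_measure.

Lemma vertex_measure_simplex (R : realType) (q : nat)
    (theta : {ffun 'I_q -> {posnum R}}) : (0 < q)%N ->
  vertex_measure theta (@simplex R q) = 1%E /\ vertex_measure theta setT = 1%E.
Proof.
move=> q0.
have t0 : total_mass theta != 0.
  rewrite gt_eqF// /total_mass (bigD1 (Ordinal q0))//= ltr_pwDl//.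
  by apply: sumr_ge0 => j _.
suff E (U : set (q.-tuple R)) : (forall j, U (basis_vector R j)) ->
    vertex_measure theta U = 1%E.
  split; apply: E => // j; split => [i|].
    by rewrite tnth_mktuple; case: eqP => _; rewrite ?ler01 ?lexx.
  rewrite (bigD1 j)//= tnth_mktuple eqxx big1 ?addr0// => i /negPf ij.
  by rewrite tnth_mktuple ij.
move=> UE; rewrite /vertex_measure.
under eq_bigr => j _ do rewrite diracE mem_set// mule1.
by rewrite sumEFin -EFinM mulVf.
Qed.

(* Main.v *)
Require Import Defs.
From mathcomp Require Import all_boot all_order all_algebra.
From mathcomp Require Import finmap multiset.
From mathcomp Require Import all_classical all_reals all_analysis.
From mathcomp Require Import measurable_realfun.
From mathcomp Require Import zify ring lra.
Set Implicit Arguments.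
Unset Strict Implicit.
Unset Printing Implicit Defensive.
Import Order.TTheory GRing.Theory Num.Theory.
Local Open Scope ring_scope.

(** The idea is to turn the consistency of the laws [P n] into equations on the
    constants [b n k j] alone, and to see that these equations leave a single
    family of solutions.

    A multipartition [B] of [n] is obtained from one of [n + 1] by removing a
    unit either from a singleton block (the ancestor is [B] with one more
    singleton of colour [j]) or from a block of size [k + 1] (the ancestor is
    [B] with a block of size [k] enlarged).  Writing the consistency relation
    over these ancestors ([sum_removal_kernel]), and expressing through the
    recursion every [P n.+1] that occurs as a multiple of [P n B], one may
    divide by [P n B] and get ([sampling_identity])
      [n + 1 = c_n + sum_(k, j) (b (n + 1) (k + 1) j / b n k j) * (k * B_kj)]
    where [c_n = sum_j b (n + 1) 1 j] and [B_kj] is the number of blocks of size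
    [k] and colour [j].  As [B] is arbitrary and [sum_(k, j) k * B_kj = n], all
    the ratios [b (n + 1) (k + 1) j / b n k j] equal
    [r_n = (n + 1 - c_n) / n] ([rate_succ]).

    Removing two distinct blocks in either order gives the second relation
    [b n a j * b (n - a) c i = b n c i * b (n - c) a j] ([rate_commute]).  Two
    singletons of different colours show that [b n 1 j] is proportional to
    [b 1 1 j], so [b (n + 1) 1 j = c_n * b 1 1 j] ([rate1]) because [c_0 = 1]; a
    singleton and a block of size 2 show that [c_n / r_n] is a constant [theta]
    ([new_rate_ratio]).  With [n * r_n = n + 1 - c_n] this forces
    [r_n = (n + 1) / (theta + n)] and [c_n = theta * (n + 1) / (theta + n)], and
    [b] is determined ([rateE]); it is the [b_star] of the parameters
    [theta_j = theta * b 1 1 j].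

    The refined Ewens law satisfies the recursion with the same constants
    ([refined_ewens_remove]) and agrees with [P] on the empty multipartition, so
    the two coincide by induction on [n].  The parameters are recovered from the
    laws at [n = 1] and [n = 2] ([refined_ewens_inj]). *)

(** * Multipartitions as multisets of blocks *)

Section Multipartitions.
Local Open Scope mset_scope.
Variable q : nat.
Implicit Types (A B : {mset color q}) (a : color q) (j : 'I_q).

Lemma mono_color_inj k l i j : (0 < k)%N ->
  mono_color k i = mono_color l j -> k = l /\ i = j.
Proof.
move=> k0 /ffunP /(_ i); rewrite !ffunE eqxx.
by case: eqP => [->|_] // k0'; rewrite k0' in k0.
Qed.

Lemma mono_color_neqS k i j : (mono_color k.+1 i == mono_color k j) = false.
Proof. by apply/eqP => /mono_color_inj[]//; lia. Qed.

Lemma mono_color_size k j : color_size (mono_color k j) = k.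
Proof.
rewrite /color_size (bigD1 j)//= big1 ?addn0 ?ffunE ?eqxx// => i /negPf ij.
by rewrite ffunE ij.
Qed.

Lemma color_pred_mono k j : color_pred (mono_color k.+1 j) j = mono_color k j.
Proof. by apply/ffunP => i; rewrite !ffunE; case: eqP => //=; rewrite subn1. Qed.

Definition total_size A : nat := (\sum_(a <- finsupp A) A a * color_size a)%N.

Lemma total_sizeE (S : {fset color q}) A : (finsupp A `<=` S)%fset ->
  total_size A = (\sum_(a <- S) A a * color_size a)%N.
Proof.
move=> sAS; apply: big_fset_incl => // a _ aA.
by rewrite (fsfun_dflt aA).
Qed.

Lemma total_sizeD A B : total_size (A `+` B) = (total_size A + total_size B)%N.
Proof.
pose S := (finsupp (A `+` B) `|` (finsupp A `|` finsupp B))%fset.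
rewrite (@total_sizeE S (A `+` B)) ?fsubsetUl//.
rewrite (@total_sizeE S A); last by rewrite /S fsetUCA fsubsetUl.
rewrite (@total_sizeE S B); last by rewrite /S fsetUA fsubsetUr.
by rewrite -big_split/=; apply: eq_bigr => a _; rewrite msetE2 mulnDl.
Qed.

Lemma total_size1 a : total_size [mset a] = color_size a.
Proof. by rewrite /total_size finsupp_msetn/= big_seq_fset1 msetnxx mul1n. Qed.

Lemma total_size0 : total_size mset0 = 0%N.
Proof. by rewrite /total_size big1// => a _; rewrite mset0E. Qed.

Lemma total_size_eq0 A : A [ffun=> 0%N] = 0%N -> total_size A = 0%N -> A = mset0.
Proof.
move=> A0 /eqP; rewrite /total_size sum_nat_seq_eq0 => /allP As.
apply/msetP => a; rewrite mset0E; case: (boolP (a \in finsupp A)) => [aA|/fsfun_dflt//].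
move: (As _ aA) => /=; rewrite muln_eq0 => /orP[/eqP//|].
rewrite sum_nat_eq0 => /forallP/= a0.
suff -> : a = [ffun=> 0%N] by [].
by apply/ffunP => i; rewrite ffunE; apply/eqP.
Qed.

Lemma subset_mset1 A a : (0 < A a)%N -> [mset a] `+` (A `\` [mset a]) = A.
Proof. by move=> Aa; rewrite msetB1K// in_mset. Qed.

Definition monochromatic A := forall a, (0 < A a)%N ->
  exists k j, (0 < k)%N /\ a = mono_color k j.

(** The bound on the block sizes follows from the total size; dropping it leaves
    two conditions that are stable under multiset sum and difference. *)
Lemma multipartitionE n A :
  multipartition n A <-> monochromatic A /\ total_size A = n.
Proof.
split=> [[[A0 An] Am]|[Am An]].
  split=> // a /Am[k [j [/andP[k0 _] ->]]]; by exists k, j.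
split.
  split=> //; apply/eqP; rewrite -leqn0 leqNgt; apply/negP => /Am[k [j [k0 /ffunP/(_ j)]]].
  by rewrite !ffunE eqxx => k00; rewrite -k00 in k0.
move=> a Aa; have [k [j [k0 ak]]] := Am _ Aa; exists k, j; split => //.
rewrite k0/= -An -(subset_mset1 Aa) total_sizeD total_size1 ak mono_color_size.
exact: leq_addr.
Qed.

Lemma monochromaticD A B :
  monochromatic A -> monochromatic B -> monochromatic (A `+` B).
Proof.
by move=> Am Bm a; rewrite msetE2 addn_gt0 => /orP[/Am|/Bm].
Qed.

Lemma monochromaticB A B : monochromatic A -> monochromatic (A `\` B).
Proof.
move=> Am a; rewrite msetE2 => Aa; apply: Am; apply: leq_trans Aa _.
exact: leq_subr.
Qed.

(** A block of size [k] and colour [j], the block of size 0 being no block at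
    all: with this convention, removing a unit from a singleton is the case
    [k = 0] of replacing a block of size [k + 1] by one of size [k]. *)
Definition block k j : {mset color q} :=
  if k is 0 then mset0 else [mset mono_color k j].

Lemma blockE k j a : block k j a = ((0 < k) && (a == mono_color k j))%N.
Proof. by case: k => [|k] /=; rewrite ?mset0E ?msetnE//; case: eqP. Qed.

Lemma monochromatic_block k j : monochromatic (block k j).
Proof.
move=> a; rewrite blockE; case: (posnP k) => //= k0.
by case: eqP => // -> _; exists k, j.
Qed.

Lemma total_size_block k j : total_size (block k j) = k.
Proof. by case: k => [|k] /=; rewrite ?total_size0 ?total_size1 ?mono_color_size. Qed.

Lemma multipartition0 A : multipartition 0 A <-> A = mset0.
Proof.
split=> [[[A0 As] _]|->]; first exact: total_size_eq0.
apply/multipartitionE; split; last exact: total_size0.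
by move=> a; rewrite mset0E.
Qed.

Lemma multipartition_block k j : multipartition k (block k j).
Proof. by apply/multipartitionE; split; [exact: monochromatic_block|exact: total_size_block]. Qed.

Lemma multipartitionD m n A B : multipartition m A -> multipartition n B ->
  multipartition (m + n) (A `+` B).
Proof.
move=> /multipartitionE[Am <-] /multipartitionE[Bm <-]; apply/multipartitionE.
by rewrite total_sizeD; split=> //; exact: monochromaticD.
Qed.

Lemma multipartition_size n A k j : multipartition n A ->
  (0 < A (mono_color k j))%N -> (0 < k <= n)%N.
Proof.
move=> [_ Am] /Am[k' [j' [k'n E]]].
have k'0 : (0 < k')%N by case/andP: k'n.
by have [<- _] := mono_color_inj k'0 (esym E).
Qed.

Lemma multipartitionB n A k j : multipartition n A ->
  (0 < A (mono_color k j))%N ->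
  multipartition (n - k) (A `\` [mset mono_color k j]).
Proof.
move=> An Ak; have /andP[k0 kn] := multipartition_size An Ak.
move/multipartitionE: An => [Am An]; apply/multipartitionE; split.
  exact: monochromaticB.
move/(congr1 total_size): (subset_mset1 Ak); rewrite total_sizeD total_size1 mono_color_size.
lia.
Qed.

Lemma multipartition_ex n A : (0 < n)%N -> multipartition n A ->
  exists k j, (0 < A (mono_color k j))%N.
Proof.
move=> n0 An; have [A0|] := pselect (forall a, A a = 0%N).
  have A0' : A = mset0 by apply/msetP => a; rewrite mset0E.
  by move/multipartitionE: An => [_]; rewrite A0' total_size0 => n00; rewrite -n00 in n0.
move/existsNP => [a /eqP]; rewrite -lt0n => Aa.
have [k [j [_ E]]] := An.2 _ Aa; by exists k, j; rewrite -E.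
Qed.

End Multipartitions.

(** * Ancestors under the removal of a unit *)

Section Ancestors.
Local Open Scope mset_scope.
Variable q : nat.
Implicit Types (A B : {mset color q}) (a : color q) (j : 'I_q).

(** The case [k = 0] stands for the creation of a singleton, which is always
    possible. *)
Definition growable B k j := (k == 0)%N || (0 < B (mono_color k j))%N.

Definition grow B k j := (B `+` block k.+1 j) `\` block k j.

Lemma growE B k j : growable B k j ->
  grow B k j `+` block k j = B `+` block k.+1 j.
Proof.
move=> Bk; apply/msetP => a; rewrite !msetE2 subnK// !blockE.
case: k Bk => [|k] //=; rewrite /growable/= => Bk.
by case: eqP => [->|_]; rewrite ?Bk ?ltn_addr.
Qed.

(** The block that was enlarged can be read off, being the only one that the
    larger multipartition has in excess. *)
Lemma grow_inj B k l i j : growable B k i -> growable B l j ->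
  grow B k i = grow B l j -> k = l /\ i = j.
Proof.
move=> Bk Bl E; have [||[->] ->//] := @mono_color_inj _ k.+1 l.+1 i j => //.
apply/eqP; have /msetP/(_ (mono_color k.+1 i)) := growE Bk.
have /msetP/(_ (mono_color k.+1 i)) := growE Bl.
rewrite -E !msetE2 !blockE eqxx mono_color_neqS andbF/=.
by case: (_ == mono_color l.+1 j) => //=; lia.
Qed.

Lemma grow_mono B k j : grow B k j (mono_color k.+1 j) = (B (mono_color k.+1 j)).+1.
Proof.
by rewrite !msetE2 !blockE eqxx/= addn1 mono_color_neqS andbF subn0.
Qed.

Lemma growB B k j : growable B k j ->
  grow B k j `\` block k.+1 j = B `\` block k j.
Proof.
move=> Bk; apply/msetP => a; have /msetP/(_ a) := growE Bk.
rewrite !msetE2; lia.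
Qed.

Lemma multipartition_grow n B k j : multipartition n B -> growable B k j ->
  multipartition n.+1 (grow B k j).
Proof.
move=> /multipartitionE[Bm Bn] Bk; apply/multipartitionE; split.
  by apply: monochromaticB; apply: monochromaticD => //; exact: monochromatic_block.
move/(congr1 (@total_size _)): (growE Bk); rewrite !total_sizeD !total_size_block; lia.
Qed.

Lemma remove_one_blockE A k j :
  remove_one A (mono_color k.+1 j) j = (A `\` block k.+1 j) `+` block k j.
Proof.
rewrite /remove_one; case: k => [|k]; first by rewrite eqxx msetD0.
rewrite color_pred_mono; case: eqP => // E.
by have [] := mono_color_inj _ E.
Qed.

Lemma remove_one_grow B k j : growable B k j ->
  remove_one (grow B k j) (mono_color k.+1 j) j = B.
Proof.
move=> Bk; rewrite remove_one_blockE growB//; apply/msetP => a.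
rewrite !msetE2 !blockE; case: k Bk => [|k]/=; first by rewrite subn0 addn0.
by rewrite /growable/= => Bk; case: eqP => [->|_] /=; lia.
Qed.

Lemma remove_one_inv A B k j : (0 < A (mono_color k.+1 j))%N ->
  B = remove_one A (mono_color k.+1 j) j -> growable B k j /\ A = grow B k j.
Proof.
move=> Ak ->; rewrite remove_one_blockE; split.
  by case: k Ak => //= k Ak; rewrite /growable msetE2 msetnxx addn1 orbT.
apply/msetP => a; rewrite !msetE2 !blockE.
case: (a =P mono_color k.+1 j) => [->|_] /=; last by rewrite subn0 addn0 addnK.
by rewrite mono_color_neqS andbF addn0 subn0 subnK.
Qed.

(** On a multipartition the block from which a unit is removed has a single
    colour, so [A] is an ancestor of [B] in the sense of [grow]. *)
Lemma removal_kernel_cases (R : realType) n A B (Am : monochromatic A) :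
  removal_kernel R n A B = 0 \/
  exists k j, [/\ growable B k j, A = grow B k j &
    removal_kernel R n A B = (k.+1 * A (mono_color k.+1 j))%:R / n%:R].
Proof.
rewrite /removal_kernel; case: pickP => [[[a aA] j] /= /andP[a0 /eqP E]|_]; last by left.
right; have Aa : (0 < A a)%N by rewrite mset_gt0 -msuppE.
have [[|k] [i [// _ aE]]] := Am _ Aa.
have ij : j = i by move: a0; rewrite aE ffunE; case: eqP.
subst i a; have [Bk AE] := remove_one_inv Aa E; exists k, j; split => //.
by rewrite ffunE eqxx.
Qed.

Lemma removal_kernel_grow (R : realType) n A B k j (Am : monochromatic A) :
  growable B k j -> A = grow B k j ->
  removal_kernel R n A B = (k.+1 * A (mono_color k.+1 j))%:R / n%:R.
Proof.
move=> Bk AE; rewrite /removal_kernel; case: pickP => [[[a aA] i] /= /andP[a0 /eqP E]|].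
  have Aa : (0 < A a)%N by rewrite mset_gt0 -msuppE.
  have [[|l] [i' [// _ aE]]] := Am _ Aa.
  have ii' : i = i' by move: a0; rewrite aE ffunE; case: eqP.
  subst i' a; have [Bl AE'] := remove_one_inv Aa E.
  have [<- <-] := grow_inj Bk Bl (etrans (esym AE) AE').
  by rewrite ffunE eqxx.
have kA : mono_color k.+1 j \in finsupp A.
  by rewrite msuppE in_mset AE grow_mono.
move/(_ ([` kA]%fset, j)) => /=.
by rewrite ffunE eqxx/= AE remove_one_grow// eqxx.
Qed.

(** The consistency sum reduced to the finitely many ancestors of [B].  The bound
    [k <= n] on the enlarged block loses nothing, as [B] has total size [n]. *)
Lemma sum_removal_kernel (R : realType) n (f : {mset color q} -> R) B :
  (forall A, ~ multipartition n.+1 A -> f A = 0) -> multipartition n B ->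
  \sum_(A \in @chromatic_partition q n.+1) f A * removal_kernel R n.+1 A B =
  (\sum_(p : 'I_n.+1 * 'I_q | growable B p.1 p.2)
    (p.1.+1)%:R * (grow B p.1 p.2 (mono_color p.1.+1 p.2))%:R * f (grow B p.1 p.2)) / n.+1%:R.
Proof.
move=> f0 Bn.
pose g (p : 'I_n.+1 * 'I_q) := grow B p.1 p.2.
pose s := [seq g p | p <- enum [pred p : 'I_n.+1 * 'I_q | growable B p.1 p.2]].
have us : uniq s.
  rewrite map_inj_in_uniq ?enum_uniq// => -[k i] [l j].
  rewrite !mem_enum !inE/= => Bk Bl /(grow_inj Bk Bl)[kl ->].
  by congr pair; apply: val_inj.
have gM (p : 'I_n.+1 * 'I_q) : growable B p.1 p.2 -> multipartition n.+1 (g p).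
  exact: multipartition_grow.
rewrite (@fsbigE _ _ _ _ _ s)//=; first last.
- move=> A _ As; have [An|/f0->] := pselect (multipartition n.+1 A); last by rewrite mul0r.
  have [->|[k [j [Bk AE _]]]] := removal_kernel_cases R n.+1 B ((multipartitionE _ _).1 An).1.
    by rewrite mulr0.
  have kn : (k < n.+1)%N.
    rewrite ltnS; case/orP: Bk => [/eqP->//|/(multipartition_size Bn)]; by case/andP.
  case/negP: As; apply/mapP; exists (Ordinal kn, j) => //.
  by rewrite mem_enum inE.
- by move=> A /= /mapP[p]; rewrite mem_enum inE => pB ->; exact: (gM _ pB).1.
rewrite big_map big_enum_cond/= mulr_suml; apply: eq_big => [p|p].
  rewrite /= ?inE; apply: andb_idr => pB; rewrite inE; exact: (gM _ pB).1.
move=> /andP[pB _].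
rewrite (@removal_kernel_grow R n.+1 _ B p.1 p.2 ((multipartitionE _ _).1 (gM _ pB)).1)//.
by rewrite natrM mulrA (mulrC (f _)).
Qed.

End Ancestors.

(** * Moments of the vertex measure *)

Section Moment.
Variables (R : realType) (q : nat).
Implicit Types (theta : {ffun 'I_q -> {posnum R}}).

Lemma measurable_simplex : measurable (@simplex R q).
Proof.
rewrite [X in measurable X](_ : _ =
  (\bigcap_(j in [set: 'I_q]) ((fun u : q.-tuple R => tnth u j) @^-1` `[0, 1]))
  `&` ((fun u : q.-tuple R => \sum_(j < q) tnth u j) @^-1` [set 1]))%classic; last first.
  apply/seteqP; split => u /=.
    by move=> [u01 u1]; split => // j _ /=; rewrite in_itv/=.
  by move=> [u01 u1]; split => // j; have := u01 j Logic.I; rewrite /= in_itv.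
apply: measurableI.
  apply: fin_bigcap_measurable => [|j _]; first exact: finite_finset.
  rewrite -[X in measurable X]setTI; exact: measurable_tnth.
rewrite -[X in measurable X]setTI.
have : measurable_fun [set: q.-tuple R] (fun u : q.-tuple R => \sum_(j < q) tnth u j).
  by apply: measurable_sum => j; exact: measurable_tnth.
by apply.
Qed.

Lemma measurable_monomial (r : color q) :
  measurable_fun [set: q.-tuple R] (fun u : q.-tuple R => \prod_(j < q) tnth u j ^+ r j).
Proof.
by apply: measurable_prod => j _; apply: measurable_funX; exact: measurable_tnth.
Qed.

Lemma basis_vector_simplex j : @simplex R q (basis_vector R j).
Proof.
split=> [i|]; first by rewrite tnth_mktuple; case: eqP => _; rewrite ?ler01 ?lexx.
rewrite (bigD1 j)//= tnth_mktuple eqxx big1 ?addr0// => i /negPf ij.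
by rewrite tnth_mktuple ij.
Qed.

Lemma total_mass_gt0 theta : (0 < q)%N -> 0 < total_mass theta.
Proof.
move=> q0; rewrite /total_mass (bigD1 (Ordinal q0))//= ltr_pwDl//.
by apply: sumr_ge0.
Qed.

(** The vertex measure is a combination of Dirac masses, so the integral is a
    sum of values at the vertices.  The combination is written with the generic
    scaling and sum of measures, for which the integral is linear. *)
Lemma moment_vertex theta r :
  moment (vertex_measure theta) r =
  (total_mass theta)^-1 * \sum_(i < q) (theta i)%:num * \prod_(j < q) (i == j)%:R ^+ r j.
Proof.
have iv0 : 0 <= (total_mass theta)^-1 by rewrite invr_ge0 total_mass_ge0.
have th0 j : 0 <= (theta j)%:num by [].
pose w (k : nat) : {measure set (q.-tuple R) -> \bar R} :=
  if insub k is Some j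
  then mscale (NngNum (th0 j)) (\d_(basis_vector R j)) else mzero.
rewrite /moment /Rintegral.
have mD := measurable_simplex.
have mf : measurable_fun (@simplex R q)
    (fun u : q.-tuple R => (\prod_(j < q) tnth u j ^+ r j)%:E).
  apply/measurable_EFinP; apply: measurable_funTS; exact: measurable_monomial.
have f0 u : @simplex R q u -> (0 <= (\prod_(j < q) tnth u j ^+ r j)%:E)%E.
  by move=> [u01 _]; rewrite lee_fin; apply: prodr_ge0 => j _; apply: exprn_ge0;
     have /andP[] := u01 j.
rewrite (@eq_measure_integral _ _ _ _ (mscale (NngNum iv0) (msum w q))); last first.
  move=> A _ _; rewrite /= /vertex_measure /mscale /= /msum; congr (_ * _)%E.
  by apply: eq_bigr => i _; rewrite /w valK.
rewrite ge0_integral_mscale// ge0_integral_measure_sum//=.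
rewrite -[RHS]/(fine _%:E) EFinM -sumEFin; congr (fine (_ * _)).
apply: eq_bigr => i _; rewrite /w valK ge0_integral_mscale//=.
rewrite integral_dirac// diracE mem_set ?mul1e; last exact: basis_vector_simplex.
rewrite EFinM; congr (_ * _%:E)%E; apply: eq_bigr => j _.
by rewrite tnth_mktuple eq_sym.
Qed.

Lemma moment_vertex_mono theta k j : (0 < k)%N ->
  moment (vertex_measure theta) (mono_color k j) = (theta j)%:num / total_mass theta.
Proof.
move=> k0; rewrite moment_vertex mulrC; congr (_ / _).
rewrite (bigD1 j)//= big1 ?mulr1 => [|i]; last first.
  by rewrite ffunE eq_sym => _; case: eqP => //= _; rewrite ?expr1n ?expr0.
rewrite big1 ?addr0// => i /negPf ij.
by rewrite (bigD1 j)//= ij ffunE eqxx expr0n gtn_eqF// mul0r mulr0.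
Qed.

(** A monomial in the single variable [u_j] vanishes at every vertex but [e_j],
    so the moment is [theta_j / theta], and the multinomial factor is 1. *)
Lemma b_star_mono theta n k j : (0 < q)%N -> (0 < k)%N ->
  b_star (total_mass theta) (vertex_measure theta) n (mono_color k j) =
  (theta j)%:num * (rising (total_mass theta) (n - k) / rising (total_mass theta) n)
  * (n`!%:R / (n - k)`!%:R).
Proof.
move=> q0 k0; rewrite /b_star mono_color_size moment_vertex_mono//.
rewrite (bigD1 j)//= big1 ?ffunE ?eqxx ?mulr1 => [|i /negPf ij]; last by rewrite ffunE ij.
have t0 := total_mass_gt0 theta q0.
have kf0 : k`!%:R != 0 :> R by rewrite pnatr_eq0 -lt0n fact_gt0.
rewrite (mulfV kf0) mul1r.
by rewrite (mulrCA (total_mass theta)) mulfV ?mulr1// gt_eqF.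
Qed.

End Moment.

(** * The refined Ewens sampling formula *)

Section Ewens.
Local Open Scope mset_scope.
Variables (R : realType) (q : nat).
Implicit Types (theta : {ffun 'I_q -> {posnum R}}) (A : {mset color q}).

Lemma risingS (x : R) n : rising x n.+1 = rising x n * (x + n%:R).
Proof. by rewrite /rising big_ord_recr. Qed.

Lemma rising_gt0 (x : R) n : 0 < x -> 0 < rising x n.
Proof. by move=> x0; apply: prodr_gt0 => i _; rewrite ltr_wpDr. Qed.

Definition ewens_weight theta n A : R :=
  \prod_(j < q) \prod_(1 <= a < n.+1)
    (((theta j)%:num / a%:R) ^+ A (mono_color a j) / (A (mono_color a j))`!%:R).

Lemma refined_ewensE theta n A : multipartition n A ->
  refined_ewens theta n A = n`!%:R / rising (total_mass theta) n * ewens_weight theta n A.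
Proof. by move=> An; rewrite /refined_ewens patchE mem_set. Qed.

Lemma refined_ewens_out theta n A : ~ multipartition n A -> refined_ewens theta n A = 0.
Proof. by move=> An; rewrite /refined_ewens patchE memNset. Qed.

(** The factors of sizes that do not occur are 1.  This lets weights of
    multipartitions of different integers be compared over the same range. *)
Lemma ewens_weight_widen theta m n A : multipartition m A -> (m <= n)%N ->
  ewens_weight theta n A = ewens_weight theta m A.
Proof.
move=> Am mn; apply: eq_bigr => j _; rewrite (big_cat_nat _ (n := m.+1))//=.
rewrite [X in _ * X]big1_seq ?mulr1// => a /=; rewrite mem_index_iota => /andP[ma _].
have -> : A (mono_color a j) = 0%N; last by rewrite fact0 divr1.
apply/eqP; rewrite -leqn0 leqNgt; apply/negP => /(multipartition_size Am)/andP[_].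
by rewrite leqNgt ma.
Qed.

(** Only the factor of index [(j, k)] changes, from [x ^ l.+1 / l.+1!] to
    [x ^ l / l!] with [x = theta_j / k]. *)
Lemma ewens_weight_remove theta n A k j : (0 < k <= n)%N -> (0 < A (mono_color k j))%N ->
  k%:R * (A (mono_color k j))%:R * ewens_weight theta n A =
  (theta j)%:num * ewens_weight theta n (A `\` [mset mono_color k j]).
Proof.
move=> kn Ak; rewrite /ewens_weight (bigD1 j)//= [in RHS](bigD1 j)//=.
rewrite [X in _ * (_ * X) = _](_ : _ = \prod_(i < q | i != j) \prod_(1 <= a < n.+1)
    (((theta i)%:num / a%:R) ^+ (A `\` [mset mono_color k j]) (mono_color a i) /
     ((A `\` [mset mono_color k j]) (mono_color a i))`!%:R)); last first.
  apply: eq_bigr => i ij; rewrite !big_seq; apply: eq_bigr => a.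
  rewrite mem_index_iota => /andP[a0 _]; rewrite msetB1E; case: eqP => [E|_]; last by rewrite subn0.
  by have [_ ij'] := mono_color_inj a0 E; rewrite ij' eqxx in ij.
rewrite !mulrA; congr (_ * _).
have kI : k \in index_iota 1 n.+1 by rewrite mem_index_iota ltnS.
rewrite (bigD1_seq k)//= ?iota_uniq// [in RHS](bigD1_seq k)//= ?iota_uniq//.
rewrite !mulrA [X in _ * X = _](_ : _ = \prod_(i <- index_iota 1 n.+1 | i != k)
   (((theta j)%:num / i%:R) ^+ (A `\` [mset mono_color k j]) (mono_color i j) /
     ((A `\` [mset mono_color k j]) (mono_color i j))`!%:R)); last first.
  rewrite big_seq_cond [in RHS]big_seq_cond; apply: eq_bigr => a.
  rewrite mem_index_iota => /andP[/andP[a0 _] ak]; rewrite msetB1E; case: eqP => [E|_]; last by rewrite subn0.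
  by have [ak' _] := mono_color_inj a0 E; rewrite ak' eqxx in ak.
congr (_ * _); rewrite msetB1E eqxx subn1.
case: (A _) Ak => // m _ /=; rewrite factS natrM exprS.
have k0 : k%:R != 0 :> R by rewrite pnatr_eq0; case: (k) kn.
have m0 : m.+1%:R != 0 :> R by rewrite pnatr_eq0.
have mf0 : m`!%:R != 0 :> R by rewrite pnatr_eq0 -lt0n fact_gt0.
by field; rewrite k0 mf0 nat1r m0.
Qed.

Lemma refined_ewens_remove theta n A k j : (0 < q)%N -> multipartition n A ->
  (0 < A (mono_color k j))%N ->
  k%:R * (A (mono_color k j))%:R * refined_ewens theta n A =
  b_star (total_mass theta) (vertex_measure theta) n (mono_color k j) *
  refined_ewens theta (n - k) (A `\` [mset mono_color k j]).
Proof.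
move=> q0 An Ak; have kn := multipartition_size An Ak; have /andP[k0 kn'] := kn.
have AB := multipartitionB An Ak.
rewrite b_star_mono// !refined_ewensE// mulrCA ewens_weight_remove//.
rewrite (ewens_weight_widen _ AB) ?leq_subr//.
have t0 := total_mass_gt0 theta q0.
have r0 m : rising (total_mass theta) m != 0 by rewrite gt_eqF// rising_gt0.
have f0 m : m`!%:R != 0 :> R by rewrite pnatr_eq0 -lt0n fact_gt0.
by field; rewrite !r0 !f0.
Qed.

Lemma refined_ewens0 theta : refined_ewens theta 0 mset0 = 1.
Proof.
rewrite refined_ewensE; last exact/multipartition0.
rewrite /rising big_ord0 fact0 divr1 mul1r /ewens_weight big1// => j _.
by rewrite big_geq.
Qed.

Lemma refined_ewens_block theta n j : (0 < q)%N -> (0 < n)%N ->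
  n%:R * refined_ewens theta n [mset mono_color n j] =
  (theta j)%:num * (n`!%:R / rising (total_mass theta) n).
Proof.
move=> q0 n0; have n1 : multipartition n [mset mono_color n j].
  by case: n n0 => // n _; exact: (multipartition_block n.+1 j).
have := @refined_ewens_remove theta n _ n j q0 n1.
rewrite msetnxx mulr1 => -> //; rewrite subnn.
have -> : [mset mono_color n j] `\` [mset mono_color n j] = mset0.
  by apply/msetP => a; rewrite msetE2 subnn mset0E.
rewrite refined_ewens0 mulr1 b_star_mono// subnn fact0 divr1.
by rewrite /rising big_ord0 div1r; ring.
Qed.

(** The one-block laws at [n = 1] give [theta_j / theta], and those at [n = 2]
    give [theta_j / (theta * (theta + 1))]; the quotient of the two is
    [theta + 1]. *)
Lemma refined_ewens_inj theta theta' : (0 < q)%N ->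
  (forall n, refined_ewens theta n =1 refined_ewens theta' n) -> theta = theta'.
Proof.
move=> q0 E.
have t0 := total_mass_gt0 theta q0; have t0' := total_mass_gt0 theta' q0.
have E1 j : (theta j)%:num / total_mass theta = (theta' j)%:num / total_mass theta'.
  have := refined_ewens_block theta j q0 (ltn0Sn 0).
  have := refined_ewens_block theta' j q0 (ltn0Sn 0).
  by rewrite E /rising !big_ord1 !addr0 factS fact0 muln1 !mul1r => -> .
have E2 j : (theta j)%:num / (total_mass theta * (total_mass theta + 1)) =
    (theta' j)%:num / (total_mass theta' * (total_mass theta' + 1)).
  have := refined_ewens_block theta j q0 (ltn0Sn 1).
  have := refined_ewens_block theta' j q0 (ltn0Sn 1).
  rewrite E /rising !big_ord_recl !big_ord0 /= !addr0 !mulr1 => -> /eqP.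
  rewrite mulrCA [in X in _ == X]mulrCA; rewrite (inj_eq (mulfI _)) ?pnatr_eq0//.
  by move=> /eqP.
have tt : total_mass theta = total_mass theta'.
  have := E2 (Ordinal q0); rewrite !invfM !mulrA E1 => /mulfI E3.
  by apply: (addIr 1); apply: invr_inj; apply: E3; rewrite mulf_neq0// ?invr_eq0 gt_eqF.
apply/ffunP => j; apply/val_inj/(mulIf (x := (total_mass theta)^-1)).
  by rewrite invr_eq0 gt_eqF.
by rewrite /= E1 tt.
Qed.

End Ewens.

(** * From the recursion to its constants *)

Section Recursive.
Local Open Scope mset_scope.
Variables (R : realType) (q : nat).
Variables (P : nat -> {mset color q} -> R) (b : nat -> nat -> 'I_q -> R).
Hypothesis q_gt0 : (0 < q)%N.
Hypothesis P_structure : multipartition_structure P.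
Hypothesis P_pos : forall n A, (1 <= n)%N -> multipartition n A -> 0 < P n A.
Hypothesis P_rec : forall n A j a, (1 <= n)%N -> multipartition n A ->
  (1 <= A (mono_color a j))%N ->
  a%:R * (A (mono_color a j))%:R * P n A =
  b n a j * P (n - a)%N (A `\` [mset mono_color a j]).
Implicit Types (A B : {mset color q}) (i j : 'I_q).

Lemma law_out n A : ~ multipartition n A -> P n A = 0.
Proof. by have [_ + _] := P_structure; apply. Qed.

Lemma law0 : P 0 mset0 = 1.
Proof.
have [/(_ 0%N)[_ _ <-] _ _] := P_structure.
suff -> : @chromatic_partition q 0 = [set mset0]%classic by rewrite fsbig_set1.
apply/seteqP; split=> [A [A0 As]|A ->]; first exact: total_size_eq0.
exact: ((multipartition0 _).2 erefl).1.
Qed.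

Lemma law_gt0 n A : multipartition n A -> 0 < P n A.
Proof.
case: n => [/multipartition0->|n]; last exact: P_pos.
by rewrite law0.
Qed.

(** The recursion read upwards, from a multipartition to the one with an
    additional block, which avoids multiset differences. *)
Lemma recursion_addE n A k j : (0 < k)%N -> multipartition n A ->
  k%:R * (A (mono_color k j)).+1%:R * P (n + k) (A `+` block k j) = b (n + k) k j * P n A.
Proof.
move=> k0 An.
have AB : multipartition (n + k) (A `+` block k j).
  by apply: multipartitionD => //; exact: multipartition_block.
have E : (A `+` block k j) (mono_color k j) = (A (mono_color k j)).+1.
  by rewrite msetE2 blockE k0 eqxx addn1.
have := @P_rec (n + k) _ j k _ AB; rewrite E addnK => -> //; last by rewrite addn_gt0 k0 orbT.
congr (_ * P _ _); apply/msetP => a; rewrite !msetE2.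
by case: k k0 {AB E} => //= k _; rewrite addnK.
Qed.

(** The recursion at a multipartition with a block [(k, j)] and at most one more
    expresses [b n k j] as a quotient of positive numbers. *)
Lemma rate_gt0 n k j : (0 < k <= n)%N -> 0 < b n k j.
Proof.
move=> /andP[k0 kn].
have Am : multipartition (n - k) (block (n - k) j) by exact: multipartition_block.
have := recursion_addE j k0 Am; rewrite subnK// => E.
have Pm := law_gt0 Am; rewrite -(pmulr_lgt0 _ Pm) -E.
rewrite !mulr_gt0 ?ltr0n//; apply: law_gt0.
rewrite -{1}(subnK kn); apply: multipartitionD => //; exact: multipartition_block.
Qed.

(** The consistency relation divided by [P n B].  The ancestor [grow B k j] and
    [B] lose the same remainder when the enlarged block, respectively the original
    one, is removed; comparing the two instances of the recursion gives the ratio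
    of their laws. *)
Lemma sampling_identity n B : multipartition n B ->
  n.+1%:R = \sum_j b n.+1 1 j +
    \sum_(k < n) \sum_j b n.+1 k.+2 j / b n k.+1 j * (k.+1%:R * (B (mono_color k.+1 j))%:R).
Proof.
move=> Bn; have PB := law_gt0 Bn; have PB0 := lt0r_neq0 PB.
have [_ _ /(_ n B Bn.1)] := P_structure.
rewrite (sum_removal_kernel _ Bn); last by move=> A; exact: law_out.
move/(congr1 (fun x => x * (n.+1%:R / P n B))).
rewrite mulrCA divff// mulr1 => ->.
rewrite mulrA divfK ?pnatr_eq0// mulr_suml.
rewrite -(pair_big_dep xpredT (fun (k : 'I_n.+1) j => growable B k j)
  (fun (k : 'I_n.+1) j => k.+1%:R * (grow B k j (mono_color k.+1 j))%:R *
    P n.+1 (grow B k j) / P n B)) /=.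
(* The summand of index 0 is the creation of a singleton. *)
rewrite big_ord_recl/=; congr (_ + _).
  apply: eq_bigr => j _.
  have -> : grow B 0 j = B `+` block 1 j.
    by apply/msetP => a; rewrite !msetE2 mset0E subn0.
  have := recursion_addE j (ltn0Sn 0) Bn; rewrite addn1 => E.
  by rewrite msetE2 blockE eqxx addn1 E mulfK.
apply: eq_bigr => k _; rewrite big_mkcond; apply: eq_bigr => j _.
rewrite -[bump 0 k]/(k.+1); have [Bk|] := boolP (growable B k.+1 j); last first.
  by rewrite /growable/= lt0n negbK => /eqP->; rewrite mulr0 mulr0.
have b0 : b n k.+1 j != 0 by rewrite gt_eqF// rate_gt0//=.
have Bk' : (0 < B (mono_color k.+1 j))%N by [].
have := P_rec (ltn0Sn n) (multipartition_grow Bn Bk) (j := j) (a := k.+2).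
rewrite grow_mono => /(_ isT) ->; rewrite (growB Bk) subSS.
have := P_rec (leq_trans (ltn0Sn k) (ltn_ord k)) Bn Bk' => E.
have -> : P (n - k.+1) (B `\` block k.+1 j) = k.+1%:R * (B (mono_color k.+1 j))%:R * P n B / b n k.+1 j.
  by rewrite E mulrAC mulfV// mul1r.
by field; rewrite PB0 b0.
Qed.

(** Build the same multipartition from a third block by adding the blocks
    [(a, j)] and [(c, i)] in either order.  The multiplicities cancel because the
    two blocks are different. *)
Lemma rate_commute n a c i j : (0 < a)%N -> (0 < c)%N -> (a + c <= n)%N ->
  mono_color a j != mono_color c i ->
  b n a j * b (n - a) c i = b n c i * b (n - c) a j.
Proof.
move=> a0 c0 acn ne; set m := (n - (a + c))%N.
pose C := block m j.
have Cm : multipartition m C by exact: multipartition_block.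
have Ca := multipartitionD Cm (multipartition_block a j).
have Cc := multipartitionD Cm (multipartition_block c i).
have := recursion_addE j a0 Cc; have := recursion_addE i c0 Ca.
have := recursion_addE j a0 Cm; have := recursion_addE i c0 Cm.
have -> : (m + a + c = n)%N by rewrite /m; lia.
have -> : (m + c + a = n)%N by rewrite /m; lia.
have -> : (m + a = n - c)%N by rewrite /m; lia.
have -> : (m + c = n - a)%N by rewrite /m; lia.
have ne' := ne; rewrite eq_sym in ne'.
rewrite (msetDAC C (block c i) (block a j)) !msetE2 !blockE (negPf ne) (negPf ne') !andbF !addn0.
set x := P n _; set u := _.+1; set v := _.+1; set y := P _ _; set z := P _ _.
move=> Ec Ea Exa Exc.
have PC : P m C != 0 by rewrite gt_eqF// law_gt0.
apply: (mulIf PC).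
rewrite -[LHS]mulrA -Ec -[RHS]mulrA -Ea.
rewrite [LHS]mulrCA -Exc [RHS]mulrCA -Exa; ring.
Qed.

(** [new_rate] and [growth_ratio] are the [c_n] and [r_n] of the introduction;
    [r_0] has no meaning. *)
Definition new_rate n := \sum_j b n.+1 1 j.
Definition growth_ratio n : R := (n.+1%:R - new_rate n) / n%:R.

Lemma new_rate_gt0 n : 0 < new_rate n.
Proof.
rewrite /new_rate (bigD1 (Ordinal q_gt0))//= ltr_pwDl ?rate_gt0//.
by apply: sumr_ge0 => j _; rewrite ltW// rate_gt0.
Qed.

Lemma new_rate0 : new_rate 0 = 1.
Proof.
have := sampling_identity ((multipartition0 (mset0 : {mset color q})).2 erefl).
by rewrite big_ord0 addr0 => /esym.
Qed.

Lemma multipartition_msetn m k j : (0 < k)%N ->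
  multipartition (m * k) (msetn m (mono_color k j)).
Proof.
move=> k0; elim: m => [|m IH]; first by rewrite msetn0; exact/multipartition0.
have -> : msetn m.+1 (mono_color k j) = block k j `+` msetn m (mono_color k j).
  apply/msetP => a; rewrite msetE2 blockE !msetnE k0 /=.
  by case: eqP => _; rewrite ?add1n.
by rewrite mulSn; apply: multipartitionD => //; exact: multipartition_block.
Qed.

Lemma sum_msetn n m k j (F : nat -> 'I_q -> R) : (0 < k <= n)%N ->
  \sum_(l < n) \sum_i F l.+1 i * (l.+1%:R * (msetn m (mono_color k j) (mono_color l.+1 i))%:R)
  = F k j * (k%:R * m%:R).
Proof.
case: k => // k /= kn; rewrite (bigD1 (Ordinal kn))//= (bigD1 j)//= msetnxx.
rewrite !big1 ?addr0// => [l lk|i ij]; last first.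
  rewrite msetnE; case: eqP => [/mono_color_inj[]// _ E|]; last by rewrite !mulr0.
  by rewrite E eqxx in ij.
apply: big1 => i _; rewrite msetnE; case: eqP => [/mono_color_inj[]// [E] _|]; last by rewrite !mulr0.
by rewrite -val_eqE/= E eqxx in lk.
Qed.

(** Test the sampling identity on [n] singletons, then on one block of size [k]
    and [n - k] singletons.  The first gives the ratio for [k = 1], and the
    difference of the two compares the ratio for [k] with it. *)
Lemma rate_succ n k j : (0 < k <= n)%N -> b n.+1 k.+1 j = growth_ratio n * b n k j.
Proof.
move=> /andP[k0 kn]; have n0 : (0 < n)%N by exact: leq_trans kn.
pose F k i := b n.+1 k.+1 i / b n k i.
have E1 : n.+1%:R = new_rate n + F 1 j * (1 * n%:R).
  have nM : multipartition n (msetn n (mono_color 1 j)).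
    by rewrite -{1}[n]muln1; exact: multipartition_msetn.
  by rewrite (sampling_identity nM) (@sum_msetn n n 1 j F).
have E2 : n.+1%:R = new_rate n + (F k j * (k%:R * 1) + F 1 j * (1 * (n - k)%:R)).
  have nM : multipartition n (msetn 1 (mono_color k j) `+` msetn (n - k)%N (mono_color 1 j)).
    rewrite -{1}(subnKC kn) -{1}[k]mul1n -{1}[(n - k)%N]muln1.
    by apply: multipartitionD; exact: multipartition_msetn.
  rewrite (sampling_identity nM); congr (_ + _).
  rewrite -(@sum_msetn n 1 k j F) ?k0// -(@sum_msetn n (n - k)%N 1 j F)// -big_split/=.
  apply: eq_bigr => l _; rewrite -big_split/=; apply: eq_bigr => i _.
  by rewrite msetE2 natrD !mulrDr.
have kR : k%:R != 0 :> R by rewrite pnatr_eq0 -lt0n.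
have nR : n%:R != 0 :> R by rewrite pnatr_eq0 -lt0n.
have b0 : b n k j != 0 by rewrite gt_eqF// rate_gt0// k0.
have F1 : F 1 j = growth_ratio n by rewrite /growth_ratio E1; field.
have Fk : F k j = growth_ratio n.
  rewrite -F1; apply: (mulIf kR); move: E1; rewrite {1}E2 natrB//; lra.
by rewrite -Fk divfK.
Qed.

Lemma growth_ratio_gt0 n : (0 < n)%N -> 0 < growth_ratio n.
Proof.
move=> n0; have := @rate_succ n 1 (Ordinal q_gt0); rewrite n0 => /(_ isT) E.
rewrite -(pmulr_lgt0 _ (_ : 0 < b n 1 (Ordinal q_gt0))) -?E ?rate_gt0//.
Qed.

(** Commuting singletons of colours [i] and [j] and summing over [i] relates
    [b n.+2 1 j] to [b n.+1 1 j]. *)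
Lemma rate1 n j : b n.+1 1 j = new_rate n * b 1 1 j.
Proof.
elim: n => [|n IH]; first by rewrite new_rate0 mul1r.
have E i : b n.+2 1 j * b n.+1 1 i = b n.+2 1 i * b n.+1 1 j.
  have [->//|ij] := eqVneq i j.
  have := @rate_commute n.+2 1 1 i j isT isT isT; rewrite subn1; apply.
  by apply: contra ij => /eqP/mono_color_inj[]// _ ->.
have := congr1 (fun f => \sum_i f i) (funext E).
rewrite -mulr_sumr -mulr_suml -/(new_rate n) -/(new_rate n.+1) IH => E'.
by apply: (mulIf (lt0r_neq0 (new_rate_gt0 n))); rewrite E' mulrCA mulrC.
Qed.

(** The ratio [c_n / r_n] is the same for all [n > 0] ([new_rate_ratio]). *)
Definition total_theta : R := new_rate 1 / growth_ratio 1.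

(** Commuting a singleton and a block of size 2 in a multipartition of [n + 3]. *)
Lemma new_rate_ratio n : (0 < n)%N -> new_rate n = total_theta * growth_ratio n.
Proof.
case: n => // n _; elim: n => [|n IH]; first by rewrite /total_theta divfK// gt_eqF// growth_ratio_gt0.
pose j := Ordinal q_gt0.
have b1 : b 1 1 j != 0 by rewrite gt_eqF// rate_gt0.
have cn : new_rate n != 0 by rewrite gt_eqF// new_rate_gt0.
have := @rate_commute n.+3 1 2 j j isT isT isT; rewrite subn1 /=.
rewrite eq_sym mono_color_neqS => /(_ isT).
have -> : (n.+3 - 2 = n.+1)%N by lia.
have -> : b n.+3 2 j = growth_ratio n.+2 * b n.+2 1 j by exact: rate_succ.
have -> : b n.+2 2 j = growth_ratio n.+1 * b n.+1 1 j by exact: rate_succ.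
rewrite (rate1 n.+2) (rate1 n.+1) (rate1 n) => E.
have {E} : new_rate n.+2 * growth_ratio n.+1 = growth_ratio n.+2 * new_rate n.+1.
  apply: (mulIf b1); apply: (mulIf b1); apply: (mulIf cn); lra.
rewrite IH mulrA [growth_ratio n.+2 * _]mulrC => /mulIf -> //.
by rewrite gt_eqF// growth_ratio_gt0.
Qed.

Lemma total_theta_gt0 : 0 < total_theta.
Proof. by rewrite divr_gt0 ?new_rate_gt0 ?growth_ratio_gt0. Qed.

(** By definition [n * r_n = n + 1 - c_n], and [c_n = theta * r_n]: a linear
    equation for [r_n]. *)
Lemma growth_ratioE n : (0 < n)%N -> growth_ratio n = n.+1%:R / (total_theta + n%:R).
Proof.
move=> n0; have n0' : n%:R != 0 :> R by rewrite pnatr_eq0 -lt0n.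
have t0 := total_theta_gt0.
have : growth_ratio n * n%:R = n.+1%:R - total_theta * growth_ratio n by rewrite -new_rate_ratio// divfK.
move=> E; apply/eqP; rewrite eq_sym -subr_eq0; apply/eqP.
have tn : total_theta + n%:R != 0 by rewrite gt_eqF// ltr_wpDr.
apply: (mulIf tn); rewrite mul0r mulrBl divfK//; move: E; lra.
Qed.

Lemma new_rateE n : new_rate n = total_theta * n.+1%:R / (total_theta + n%:R).
Proof.
case: n => [|n]; last by rewrite new_rate_ratio// growth_ratioE// mulrA.
by rewrite new_rate0 mulr1 addr0 divff// gt_eqF// total_theta_gt0.
Qed.

(** Peel the block down to a singleton with [rate_succ], then use [rate1]. *)
Lemma rateE n k j : (0 < k <= n)%N ->
  b n k j = total_theta * b 1 1 j * (rising total_theta (n - k) / rising total_theta n)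
            * (n`!%:R / (n - k)`!%:R).
Proof.
have t0 := total_theta_gt0.
have r0 m : rising total_theta m != 0 by rewrite gt_eqF// rising_gt0.
have f0 m : m`!%:R != 0 :> R by rewrite pnatr_eq0 -lt0n fact_gt0.
have tn m : total_theta + m%:R != 0 by rewrite gt_eqF// ltr_wpDr.
case: k => // k; elim: k n => [|k IH] [|n] // kn.
  rewrite rate1 new_rateE subn1/= risingS factS natrM.
  by field; rewrite r0 f0 tn.
rewrite rate_succ// IH// growth_ratioE; last by lia.
rewrite subSS risingS factS natrM.
by field; rewrite !r0 !f0 tn.
Qed.

(** The numbers [b 1 1 j] have sum [c_0 = 1]: they are the proportions of the
    colours. *)
Definition ewens_param : {ffun 'I_q -> {posnum R}} :=
  [ffun j => PosNum (mulr_gt0 total_theta_gt0 (@rate_gt0 1 1 j isT))].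

Lemma total_mass_ewens_param : total_mass ewens_param = total_theta.
Proof.
rewrite /total_mass; under eq_bigr => j _ do rewrite ffunE/=.
by rewrite -mulr_sumr -/(new_rate 0) new_rate0 mulr1.
Qed.

Lemma rate_b_star n k j : (0 < k <= n)%N ->
  b n k j = b_star (total_mass ewens_param) (vertex_measure ewens_param) n (mono_color k j).
Proof.
move=> kn; have /andP[k0 _] := kn.
by rewrite b_star_mono// rateE// total_mass_ewens_param ffunE.
Qed.

(** Both laws satisfy the same recursion, which reduces a nonempty multipartition
    to one with a block less. *)
Lemma law_ewens n : P n =1 refined_ewens ewens_param n.
Proof.
elim/ltn_ind: n => n IH A.
have [An|An] := pselect (multipartition n A); last first.
  by rewrite law_out// refined_ewens_out.
case: n => [|n] in IH An *.
  by move/multipartition0: An => ->; rewrite law0 refined_ewens0.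
have [k [j Ak]] := multipartition_ex (ltn0Sn n) An.
have kn := multipartition_size An Ak; have /andP[k0 kn'] := kn.
have kA : k%:R * (A (mono_color k j))%:R != 0 :> R.
  by rewrite mulf_neq0// pnatr_eq0 -lt0n.
apply: (mulfI kA); rewrite P_rec// refined_ewens_remove// rate_b_star//.
by rewrite IH// ltn_subrL k0.
Qed.

End Recursive.

(** * The characterization *)

Theorem proposition5p49 (R : realType) (q : nat) (q_ge1 : (1 <= q)%N)
    (P : nat -> {mset color q}%mset -> R) (b : nat -> nat -> 'I_q -> R)
    (P_structure : multipartition_structure P)
    (P_pos : forall (n : nat) (A : {mset color q}%mset),
        (1 <= n)%N -> multipartition n A -> 0 < P n A)
    (P_rec : forall (n : nat) (A : {mset color q}%mset) (j : 'I_q) (a : nat),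
        (1 <= n)%N -> multipartition n A -> (1 <= A (mono_color a j))%N ->
        a%:R * (A (mono_color a j))%:R * P n A
        = b n a j * P (n - a)%N (A `\` [mset mono_color a j])%mset) :
  exists theta : {ffun 'I_q -> {posnum R}},
    [/\ forall n : nat, P n =1 refined_ewens theta n,
        forall theta' : {ffun 'I_q -> {posnum R}},
          (forall n : nat, P n =1 refined_ewens theta' n) -> theta' = theta
      & forall (n a : nat) (j : 'I_q), (1 <= a <= n)%N ->
          b n a j
          = b_star (total_mass theta) (vertex_measure theta) n (mono_color a j)].
Proof.
exists (ewens_param q_ge1 P_structure P_pos P_rec).
have PE := law_ewens q_ge1 P_structure P_pos P_rec.
split => // [theta' P'|n a j an]; last exact: rate_b_star.
by apply: refined_ewens_inj => // n A; rewrite -P' PE.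
Qed.
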